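(* Let $G$ be a graph with at least one edge. Then the following are equivalent: (1) $G$ satisfies the weak square condition (WSC); (2) $G$ is a domain; (3) the ring $\bar{A}(G)$ is a domain (i.e. an integral domain); (4) the graph $G^{0-1}$ has no isolated vertices.
   Context: Graphs are finite, simple, undirected, with vertex set $\{1,\dots,n\}$, $n\ge 1$. $\mathbb{N}$ denotes the nonnegative integers. For $k\in\mathbb{N}$, a $k$-cover of $G$ is a nonzero vector $\mathbf{a}=(a_1,\dots,a_n)\in\mathbb{N}^n$ such that $a_i+a_j\ge k$ for every edge $\{i,j\}$ of $G$. A $k$-cover is basic if it cannot be written as the (vertex-wise) sum of a $k$-cover and a $0$-cover (covers are nonzero by definition). $G$ is a domain if for all $s,t\in\mathbb{N}$, not both zero, the sum of any $s$ basic $1$-covers (repetitions allowed) and any $t$ basic $2$-covers (repetitions allowed) of $G$ is a basic $(s+2t)$-cover of $G$. $G$ satisfies WSC if $G$ has at least one edge, and for every non-isolated vertex $i$ there exists an edge $\{i,j\}$ of $G$ such that for all edges $\{i,i'\}$ and $\{j,j'\}$ of $G$, $\{i',j'\}$ is also an edge of $G$ (in particular $i'\neq j'$). Let $S=K[x_1,\dots,x_n]$ be a polynomial ring over some field $K$ with irrelevant ideal $\mathfrak{m}=(x_1,\dots,x_n)$. The cover ideal of $G$ is $J(G)=\bigcap_{\{i,j\}}(x_i,x_j)$, the intersection over all edges $\{i,j\}$ of $G$. Let $J(G)^{(k)}$ be its $k$-th symbolic power, $R_s(J(G))=\bigoplus_{k\ge 0}J(G)^{(k)}$ its symbolic Rees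 algebra, and $\bar{A}(G)=R_s(J(G))/\mathfrak{m}R_s(J(G))$ (the symbolic fiber cone of $J(G)$, also called the basic covers algebra of $G$). For a graph $G$ with at least one edge, $G^{red}$ is the graph obtained from $G$ by deleting all isolated vertices, and $G^{0-1}$ is the graph whose vertices are the vertices of $G^{red}$ and whose edges are the edges $\{i,j\}$ of $G$ such that $a_i+a_j=1$ for every basic $1$-cover $\mathbf{a}$ of $G$. *)

(* Defs.v *)
From HB Require Import structures.
From mathcomp Require Import all_boot all_order all_algebra.
From mathcomp Require Import boolp.
From mathcomp.multinomials Require Import mpoly.

Set Implicit Arguments.
Unset Strict Implicit.
Unset Printing Implicit Defensive.

Import GRing.Theory.
Local Open Scope ring_scope.

Record sgraph (T : Type) := SGraph {
  adj :> rel T;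
  adj_sym : ssrbool.symmetric adj;
  adj_irr : irreflexive adj }.

Definition has_edge (T : Type) (G : sgraph T) : Prop := exists i j, G i j.

Definition non_isolated (T : finType) (G : sgraph T) (i : T) : bool :=
  [exists j, G i j].

Definition no_isolated_vertex (T : finType) (G : sgraph T) : Prop :=
  forall i, non_isolated G i.

Definition WSC (T : finType) (G : sgraph T) : Prop :=
  has_edge G /\
  forall i, non_isolated G i ->
    exists2 j, G i j & forall i' j', G i i' -> G j j' -> G i' j'.

Definition cover n (G : sgraph 'I_n) (k : nat) (a : 'X_{1..n}) : Prop :=
  a <> 0%MM /\ forall i j, G i j -> (k <= a i + a j)%N.

Definition basic_cover n (G : sgraph 'I_n) (k : nat) (a : 'X_{1..n}) : Prop :=
  cover G k a /\
  ~ exists b c, [/\ cover G k b, cover G 0 c & a = (b + c)%MM].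

Definition graph_domain n (G : sgraph 'I_n) : Prop :=
  forall (s t : nat) (a : 'I_s -> 'X_{1..n}) (b : 'I_t -> 'X_{1..n}),
    (s, t) <> (0, 0)%N ->
    (forall i, basic_cover G 1 (a i)) ->
    (forall i, basic_cover G 2 (b i)) ->
    basic_cover G (s + 2 * t) (\sum_(i < s) a i + \sum_(i < t) b i)%MM.

Definition G01_adj n (G : sgraph 'I_n) : rel {i | non_isolated G i} :=
  fun u v => G (val u) (val v) &&
    `[< forall a, basic_cover G 1 a -> (a (val u) + a (val v) = 1)%N >].

Lemma G01_sym n (G : sgraph 'I_n) : ssrbool.symmetric (@G01_adj n G).
Proof.
move=> u v; rewrite /G01_adj adj_sym; congr (_ && _).
by apply: asbool_equiv_eq; split=> + a /[dup] ab => /(_ a ab); rewrite addnC.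
Qed.

Lemma G01_irr n (G : sgraph 'I_n) : irreflexive (@G01_adj n G).
Proof. by move=> u; rewrite /G01_adj adj_irr. Qed.

Definition G01 n (G : sgraph 'I_n) : sgraph {i | non_isolated G i} :=
  SGraph (@G01_sym n G) (@G01_irr n G).

Definition ideal_gen (R : comNzRingType) (X : R -> Prop) : {pred R} :=
  fun f => `[< exists (m : nat) (c x : 'I_m -> R),
    (forall i, X (x i)) /\ f = \sum_(i < m) c i * x i >].

Definition ideal_pow (R : comNzRingType) (I : {pred R}) (k : nat) : {pred R} :=
  ideal_gen (fun f => exists x : 'I_k -> R,
    (forall i, x i \in I) /\ f = \prod_(i < k) x i).

(* In the library, [idealr_closed] includes properness. *)
Definition prime_ideal (R : comNzRingType) (P : {pred R}) : Prop :=
  idealr_closed P /\ prime_idealr_closed P.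

Definition minimal_prime (R : comNzRingType) (I P : {pred R}) : Prop :=
  [/\ prime_ideal P, {subset I <= P} &
   forall Q : {pred R}, prime_ideal Q -> {subset I <= Q} ->
     {subset Q <= P} -> {subset P <= Q}].

(* The intersection of the contractions to R of the ideals I^k R_P, over the
   minimal primes P of I: f / 1 lies in I^k R_P iff s * f is in I^k for some
   s outside P.  For a radical ideal, such as the cover ideal, these P are
   also the associated primes. *)
Definition sym_pow (R : comNzRingType) (I : {pred R}) (k : nat) : {pred R} :=
  fun f => `[< forall P : {pred R}, minimal_prime I P ->
    exists2 s, s \notin P & s * f \in ideal_pow I k >].

(* The symbolic Rees algebra, as the subring of the polynomials in R[t] whose
   coefficient of t^k lies in the k-th symbolic power, for all k. *)
Definition sym_rees_pred (R : comNzRingType) (I : {pred R}) : {pred {poly R}} :=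
  fun p => `[< forall k, p`_k \in sym_pow I k >].

Section SymbolicTheory.
Context (R : comNzRingType).
Implicit Types (X : R -> Prop) (I P : {pred R}).

Lemma ideal_gen0 X : 0 \in ideal_gen X.
Proof.
apply/asboolP; exists 0%N, (fun=> 0), (fun=> 0).
by split; [case | rewrite big_ord0].
Qed.

Lemma ideal_genD X : {in ideal_gen X &, forall f g, f + g \in ideal_gen X}.
Proof.
move=> f g /asboolP[m [c [x [xX ->]]]] /asboolP[p [d [y [yX ->]]]].
apply/asboolP; exists (m + p)%N.
exists (fun i => match split i with inl j => c j | inr j => d j end).
exists (fun i => match split i with inl j => x j | inr j => y j end).
split; first by move=> i; case: (split i).
rewrite big_split_ord; congr (_ + _); apply: eq_bigr => i _.
  by rewrite -[lshift p i]/(unsplit (inl i)) unsplitK.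
by rewrite -[rshift m i]/(unsplit (inr i)) unsplitK.
Qed.

Lemma ideal_genM X a : {in ideal_gen X, forall f, a * f \in ideal_gen X}.
Proof.
move=> f /asboolP[m [c [x [xX ->]]]]; apply/asboolP.
exists m, (fun i => a * c i), x; split=> //.
by rewrite mulr_sumr; apply: eq_bigr => i _; rewrite mulrA.
Qed.

Lemma ideal_gen_base X f : X f -> f \in ideal_gen X.
Proof.
move=> Xf; apply/asboolP; exists 1%N, (fun=> 1), (fun=> f).
by split=> //; rewrite big_ord1 mul1r.
Qed.

Lemma ideal_pow0 I f : f \in ideal_pow I 0.
Proof.
rewrite -[f]mulr1; apply/ideal_genM/ideal_gen_base.
by exists (fun=> 0); split; [case | rewrite big_ord0].
Qed.

Lemma ideal_powM I k l f g :
  f \in ideal_pow I k -> g \in ideal_pow I l -> f * g \in ideal_pow I (k + l).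
Proof.
move=> /asboolP[m [c [x [xX ->]]]] /asboolP[p [d [y [yX ->]]]].
rewrite mulr_suml; apply: (big_ind (fun h => h \in ideal_pow I (k + l))).
- exact: ideal_gen0.
- exact: ideal_genD.
move=> i _; rewrite mulr_sumr.
apply: (big_ind (fun h => h \in ideal_pow I (k + l))).
- exact: ideal_gen0.
- exact: ideal_genD.
move=> j _; rewrite mulrACA; apply/ideal_genM/ideal_gen_base.
have [u [uI ->]] := xX i; have [v [vI ->]] := yX j.
exists (fun i => match split i with inl j => u j | inr j => v j end).
split; first by move=> h; case: (split h).
rewrite big_split_ord; congr (_ * _); apply: eq_bigr => h _.
  by rewrite -[lshift l h]/(unsplit (inl h)) unsplitK.
by rewrite -[rshift k h]/(unsplit (inr h)) unsplitK.
Qed.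

Lemma prime_ideal_notinM P s t :
  prime_ideal P -> s \notin P -> t \notin P -> s * t \notin P.
Proof.
move=> [_ pP] sP tP; apply/negP => /pP.
by rewrite (negbTE sP) (negbTE tP).
Qed.

Lemma prime_ideal_notin1 P : prime_ideal P -> 1 \notin P.
Proof. by case=> -[]. Qed.

Lemma sym_pow0 I f : f \in sym_pow I 0.
Proof.
apply/asboolP => P [pP _ _]; exists 1; first exact: prime_ideal_notin1.
exact: ideal_pow0.
Qed.

Lemma sym_pow_zero I k : 0 \in sym_pow I k.
Proof.
apply/asboolP => P [pP _ _]; exists 1; first exact: prime_ideal_notin1.
by rewrite mulr0; apply: ideal_gen0.
Qed.

Lemma sym_powD I k : {in sym_pow I k &, forall f g, f + g \in sym_pow I k}.
Proof.
move=> f g /asboolP fI /asboolP gI; apply/asboolP => P mP.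
have [s sP sf] := fI P mP; have [t tP tg] := gI P mP.
exists (s * t); first by case: mP => pP _ _; exact: prime_ideal_notinM.
rewrite mulrDr; apply: ideal_genD.
  by rewrite mulrAC mulrC; apply: ideal_genM.
by rewrite -mulrA; apply: ideal_genM.
Qed.

Lemma sym_powM I k l f g :
  f \in sym_pow I k -> g \in sym_pow I l -> f * g \in sym_pow I (k + l).
Proof.
move=> /asboolP fI /asboolP gI; apply/asboolP => P mP.
have [s sP sf] := fI P mP; have [t tP tg] := gI P mP.
exists (s * t); first by case: mP => pP _ _; exact: prime_ideal_notinM.
by rewrite mulrACA; apply: ideal_powM.
Qed.

Lemma sym_powZ I k a f : f \in sym_pow I k -> a * f \in sym_pow I k.
Proof. by move=> fI; rewrite -[k]add0n sym_powM ?sym_pow0. Qed.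

Lemma sym_rees_subring I : subring_closed (sym_rees_pred I).
Proof.
split.
- apply/asboolP => -[|k]; first exact: sym_pow0.
  by rewrite coef1 sym_pow_zero.
- move=> p q /asboolP pI /asboolP qI; apply/asboolP => k.
  by rewrite coefB -mulN1r sym_powD ?sym_powZ.
move=> p q /asboolP pI /asboolP qI; apply/asboolP => k.
rewrite coefM; apply: (big_ind (fun h => h \in sym_pow I k)).
- exact: sym_pow_zero.
- exact: sym_powD.
by move=> i _; rewrite -[k in sym_pow I k](subnKC (leq_ord i)) sym_powM.
Qed.

End SymbolicTheory.

HB.instance Definition _ (R : comNzRingType) (I : {pred R}) :=
  GRing.isSubringClosed.Build {poly R} (sym_rees_pred I) (sym_rees_subring I).

Record sym_rees (R : comNzRingType) (I : {pred R}) := SymRees {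
  rees_val :> {poly R};
  rees_valP : rees_val \in sym_rees_pred I }.

HB.instance Definition _ (R : comNzRingType) (I : {pred R}) :=
  [isSub for @rees_val R I].
HB.instance Definition _ (R : comNzRingType) (I : {pred R}) :=
  [Choice of sym_rees I by <:].
HB.instance Definition _ (R : comNzRingType) (I : {pred R}) :=
  [SubChoice_isSubComNzRing of sym_rees I by <:].

Lemma rees_const_subproof (R : comNzRingType) (I : {pred R}) (f : R) :
  f%:P \in sym_rees_pred I.
Proof.
apply/asboolP => -[|k]; first exact: sym_pow0.
by rewrite coefC sym_pow_zero.
Qed.

Definition rees_const (R : comNzRingType) (I : {pred R}) (f : R) : sym_rees I :=
  SymRees (rees_const_subproof I f).

Definition irrelevant_ideal (K : fieldType) n : {pred {mpoly K[n]}} :=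
  ideal_gen (fun f => exists i, f = 'X_i).

Arguments irrelevant_ideal K n : clear implicits.

Definition cover_ideal (K : fieldType) n (G : sgraph 'I_n) :
    {pred {mpoly K[n]}} :=
  fun f => `[< forall i j, G i j -> f \in ideal_gen (fun g => g = 'X_i \/ g = 'X_j) >].

Arguments cover_ideal K {n} G.

Definition irrelevant_rees (K : fieldType) n (G : sgraph 'I_n) :
    {pred sym_rees (cover_ideal K G)} :=
  ideal_gen (fun r => exists2 f, f \in irrelevant_ideal K n & r = rees_const _ f).

Arguments irrelevant_rees K {n} G.

Lemma irrelevant_ideal_mcoeff0 (K : fieldType) n (f : {mpoly K[n]}) :
  f \in irrelevant_ideal K n -> f@_0%MM = 0.
Proof.
move=> /asboolP[m [c [x [xX ->]]]]; rewrite raddf_sum big1 // => i _ /=.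
have [j ->] := xX i; rewrite (rmorphM (mcoeff 0)) /= mcoeffX.
by case: eqP => [/mnmP/(_ j)|]; rewrite ?mulr0 // mnm1E eqxx mnm0E.
Qed.

Lemma irrelevant_rees_ideal (K : fieldType) n (G : sgraph 'I_n) :
  idealr_closed (irrelevant_rees K G).
Proof.
split; first exact: ideal_gen0.
  apply/negP => /asboolP[m [c [x [xX]]]].
  move=> /(congr1 (fun r : sym_rees _ => (val r)`_0@_0%MM)).
  rewrite rmorph1 raddf_sum coef_sum raddf_sum /= big1 => [/eqP|i _].
    by rewrite coef1 mcoeff1 eqxx oner_eq0.
  have [f fm ->] := xX i; rewrite coef0M (rmorphM (mcoeff 0)) /= coefC /=.
  by rewrite (irrelevant_ideal_mcoeff0 fm) mulr0.
move=> a f g fI gI; apply: ideal_genD => //; exact: ideal_genM.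
Qed.

HB.instance Definition _ (K : fieldType) n (G : sgraph 'I_n) :=
  isIdealr.Build (sym_rees (cover_ideal K G)) (irrelevant_rees K G)
    (@irrelevant_rees_ideal K n G).

Definition basic_covers_algebra (K : fieldType) n (G : sgraph 'I_n) :=
  {ideal_quot (irrelevant_rees K G : idealr (sym_rees (cover_ideal K G)))}.

Arguments basic_covers_algebra K {n} G.

(* Main.v *)
Require Import Defs.
From mathcomp Require Import all_boot all_order all_algebra.
From mathcomp Require Import boolp zify.
From mathcomp.multinomials Require Import mpoly.

Set Implicit Arguments.
Unset Strict Implicit.
Unset Printing Implicit Defensive.

Import GRing.Theory.

(** Call a vector of naturals tight of degree k if it satisfies all the edge
inequalities k <= a_i + a_j and no positive coordinate can be lowered, which
means that each of them lies on an edge where the inequality is an equality.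
For k > 0 these vectors are the basic k-covers ([basic_coverP]), while the zero
vector is the only tight one of degree 0.  All four conditions amount to one: the sum of a tight
vector of degree k and one of degree l is tight of degree k + l
([tight_additive]).

Combinatorics.  If the edge ij is as in WSC, then a_i + a_j = k for all tight a of
degree k: if i and j both have positive coordinates, the two equalities at i'
and j' add up against the inequality of the edge i'j' ([tight_partner]).  These
equalities add, so WSC gives additivity, which in turn gives the graph domain
property by adding up basic covers of degrees 1 and 2.  If G is a domain, a vertex i
isolated in G01 is impossible: each neighbour j of i has a basic 1-cover equal
to 1 at both i and j, and in the sum of these covers the coordinate of i is
positive although no edge at i is an equality ([domain_G01]).  Finally, if ij is an
edge of G01 but i' and j' are not adjacent, the complement of {i', j'} is a
1-cover; a basic one below it vanishes at i' and j', so it takes the value 1 at both i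
and j, against the choice of ij ([G01_WSC]).

Algebra.  The k-th symbolic power of J(G) is spanned by the monomials x^a where a
satisfies the inequalities of degree k ([sym_powP]), because the minimal primes
of J(G) are the ideals (x_i, x_j) of the edges.  An element of the symbolic Rees
algebra is then in m R_s exactly when none of its monomials x^a t^k has a tight of
degree k ([irrelevant_reesP]), so the tight monomials form a basis of the fiber
cone.  If the latter is a domain, the product of two such monomials is
nonzero, which is additivity; conversely, additivity makes the
monomials that are not tight the complement of a submonoid, and comparing
extremal terms shows that the ideal they span is prime. *)

(** * Tight covers *)

Section Covers.
Variables (n : nat) (G : sgraph 'I_n).
Implicit Types (a b c : 'X_{1..n}) (k l : nat).

(** Contrary to [cover], this admits the zero vector, so that the degree 0 part
of the Rees algebra fits the same description as the others. *)
Definition covers k a : bool :=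
  [forall i, forall j, G i j ==> (k <= a i + a j)].

Definition tight k a : bool :=
  covers k a && [forall i, (0 < a i) ==> [exists j, G i j && (a i + a j == k)]].

(** The condition to which the four equivalent ones are compared. *)
Definition tight_additive : Prop :=
  forall k l a b, tight k a -> tight l b -> tight (k + l) (a + b)%MM.

Lemma coversP k a :
  reflect (forall i j, G i j -> k <= a i + a j) (covers k a).
Proof.
apply: (iffP forallP) => [H i j Gij|H i]; first by apply: (implyP (forallP (H i) j)).
by apply/forallP => j; apply/implyP/H.
Qed.

Lemma tightP k a :
  reflect (covers k a /\
           forall i, 0 < a i -> exists2 j, G i j & a i + a j = k)
          (tight k a).
Proof.
apply: (iffP andP) => -[ca H]; split=> //.
  move=> i ai; have /existsP[j /andP[Gij /eqP]] := implyP (forallP H i) ai.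
  by exists j.
apply/forallP => i; apply/implyP => /H[j Gij e].
by apply/existsP; exists j; rewrite Gij e eqxx.
Qed.

Lemma tight_covers k a : tight k a -> covers k a.
Proof. by case/andP. Qed.

Lemma covers0 a : covers 0 a.
Proof. exact/coversP. Qed.

Lemma coversD k l a b :
  covers k a -> covers l b -> covers (k + l) (a + b)%MM.
Proof.
move=> /coversP ca /coversP cb; apply/coversP => i j Gij.
by have := ca i j Gij; have := cb i j Gij; rewrite !mnmDE; lia.
Qed.

Lemma tight0 a : tight 0 a = (a == 0%MM).
Proof.
apply/tightP/eqP => [[_ ta]|->]; last first.
  by split=> [|i]; rewrite ?covers0 ?mnm0E.
apply/mnmP => i; rewrite mnm0E; apply/eqP.
by case: posnP => // ai; have [j _] := ta i ai; lia.
Qed.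

(** Each summand inherits tightness: an equality on an edge for the sum of two
vectors forces equality for both. *)
Lemma tight_addl k l a b :
  covers k a -> covers l b -> tight (k + l) (a + b)%MM -> tight k a.
Proof.
move=> ca cb /tightP[_ tab]; apply/tightP; split=> // i ai.
have [|j Gij] := tab i; first by rewrite mnmDE; lia.
rewrite !mnmDE => e; exists j => //.
by have := coversP _ _ ca i j Gij; have := coversP _ _ cb i j Gij; lia.
Qed.

Lemma tight_addr k l a b :
  covers k a -> covers l b -> tight (k + l) (a + b)%MM -> tight l b.
Proof. by move=> ca cb; rewrite addnC addmC; apply: tight_addl. Qed.

(** Lowering a coordinate i that lies on no tight edge keeps the inequalities;
iterating this leads to a tight vector. *)
Lemma not_tightP k a :
  covers k a -> ~~ tight k a ->
  exists2 i, (U_(i) <= a)%MM & covers k (a - U_(i))%MM.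
Proof.
move=> ca; rewrite /tight ca /= => /forallPn[i].
rewrite negb_imply => /andP[ai /existsPn Hi]; exists i.
  by rewrite lep1mP -lt0n.
have Hl j : G i j -> k < a i + a j.
  move=> Gij; have := coversP _ _ ca i j Gij; have := Hi j.
  by rewrite Gij /=; lia.
apply/coversP => u v Guv; have := coversP _ _ ca u v Guv.
rewrite !mnmBE !mnm1E; case: eqP => [eu|_]; case: eqP => [ev|_]; subst.
- by rewrite adj_irr in Guv.
- by have := Hl v Guv; lia.
- by rewrite adj_sym in Guv; have := Hl u Guv; lia.
- by rewrite !subn0.
Qed.

Lemma covers_tight k a : covers k a -> exists2 b, (b <= a)%MM & tight k b.
Proof.
have [m] := ubnP (mdeg a); elim: m a => // m IHm a am ca.
have [ta|/(not_tightP ca)[i ia ci]] := boolP (tight k a).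
  by exists a; rewrite ?lepm_refl.
have [|b ba tb] := IHm _ _ ci.
  by move: am; rewrite -{1}(submK ia) mdegD mdeg1; lia.
by exists b => //; apply: lepm_trans ba (lem_subr _ _).
Qed.

Hypothesis hG : has_edge G.

(** For k > 0 an edge prevents the vector left after lowering a coordinate from
being zero; for k = 0 the unit vectors are basic, but not tight. *)
Lemma basic_coverP k a : 0 < k -> basic_cover G k a <-> tight k a.
Proof.
move=> k_gt0.
have nz b : covers k b -> b <> 0%MM.
  move=> /coversP cb b0; have [i [j /cb]] := hG.
  by rewrite b0 !mnm0E; lia.
split=> [[[_ /coversP ca] bas]|ta]; last first.
  have ca := tight_covers ta; split; first by split; [exact: nz|exact/coversP].
  move=> [b [c [[_ /coversP cb] [c0 _] e]]]; apply: c0; apply/eqP.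
  by rewrite -tight0; apply: (tight_addr cb (covers0 c)); rewrite addn0 -e.
apply: contra_notT bas => /(not_tightP ca)[i ia ci].
exists (a - U_(i))%MM, U_(i)%MM; split; last by rewrite submK.
  by split; [exact: nz|exact/coversP].
by split=> //; apply/eqP; rewrite mnm1_eq0.
Qed.

Lemma tight1_le1 a i : tight 1 a -> a i <= 1.
Proof.
move=> /tightP[_ ta]; case: (posnP (a i)) => [->//|ai].
by have [j _] := ta i ai; lia.
Qed.

(** If both a i and a j are positive, then a i + a i' = k = a j + a j' for some
neighbours, while a i' + a j' >= k, so a i + a j <= k.  If one of them is zero,
the other one is at most k as it lies on an edge with equality. *)
Lemma tight_partner k a i j : tight k a -> G i j ->
  (forall i' j', G i i' -> G j j' -> G i' j') -> a i + a j = k.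
Proof.
move=> /tightP[/coversP ca ta] Gij sq; have := ca i j Gij.
rewrite leq_eqVlt => /orP[/eqP//|lt].
case: (posnP (a i)) => ai.
  by have [|i' _] := ta j; lia.
case: (posnP (a j)) => aj; first by have [j' _] := ta i ai; lia.
have [i' Gi ei] := ta i ai; have [j' Gj ej] := ta j aj.
by have := ca _ _ (sq _ _ Gi Gj); lia.
Qed.

Lemma WSC_tight_additive : WSC G -> tight_additive.
Proof.
move=> [_ sq] k l a b ta tb; apply/tightP.
split; first exact: coversD (tight_covers ta) (tight_covers tb).
move=> i; rewrite mnmDE addn_gt0 => abi.
have [|j Gij sqij] := sq i.
  case/orP: abi => ci.
    by have /tightP[_ /(_ i ci)[j Gij _]] := ta; apply/existsP; exists j.
  by have /tightP[_ /(_ i ci)[j Gij _]] := tb; apply/existsP; exists j.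
exists j => //; rewrite !mnmDE.
by have := tight_partner ta Gij sqij; have := tight_partner tb Gij sqij; lia.
Qed.

Lemma tight_sum k s (a : 'I_s -> 'X_{1..n}) :
  tight_additive -> (forall i, tight k (a i)) ->
  tight (s * k) (\sum_(i < s) a i)%MM.
Proof.
move=> tadd; elim: s a => [|s IHs] a ta; first by rewrite big_ord0 tight0.
by rewrite big_ord_recl mulSn; apply: tadd => //; apply: IHs.
Qed.

Lemma tight_additive_domain : tight_additive -> graph_domain G.
Proof.
move=> tadd s t a b st0 ta tb; apply/basic_coverP.
  by case: s st0 {a ta} => //; case: t {b tb}.
rewrite mulnC -{1}[s]muln1; apply: (tadd); apply: (tight_sum tadd) => i.
  by apply/(basic_coverP (a i) (isT : 0 < 1)); apply: ta.
by apply/(basic_coverP (b i) (isT : 0 < 2)); apply: tb.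
Qed.

Lemma domain_sum_tight1 s (a : 'I_s -> 'X_{1..n}) :
  graph_domain G -> 0 < s -> (forall i, tight 1 (a i)) ->
  tight s (\sum_(i < s) a i)%MM.
Proof.
move=> dom s_gt0 ta.
have := dom s 0 a (fun=> 0%MM); rewrite big_ord0 addm0 addn0 => H.
apply/basic_coverP => //; apply: H => [|i|[]//].
- by case=> s0; rewrite s0 in s_gt0.
- exact/basic_coverP.
Qed.

(** The sum over the neighbours j of i of a basic 1-cover that exceeds 1 on the
edge ij has the coordinate #|N(i)| at i, hence tightness at i gives a
neighbour j where it vanishes, although the cover chosen for j is 1 there. *)
Lemma domain_G01 : graph_domain G -> no_isolated_vertex (G01 G).
Proof.
move=> dom u; apply: contrapT => iso; set i := val u.
have wit j : exists a, G i j -> tight 1 a /\ a i + a j <> 1.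
  have [Gij|_] := boolP (G i j); last by exists 0%MM.
  have nj : non_isolated G j by apply/existsP; exists i; rewrite adj_sym.
  apply: contrapT => no; apply: iso; apply/existsP; exists (exist _ j nj).
  rewrite /G01 /= /G01_adj /= -/i Gij; apply/asboolP => a ba.
  apply: contrapT => ne; apply: no; exists a => _; split=> //.
  exact/basic_coverP.
pose a j := sval (cid (wit j)).
have aP j : G i j -> tight 1 (a j) /\ a j i + a j j <> 1 by exact: svalP (cid (wit j)).
pose N := [set j | G i j].
have NP (j : 'I_#|N|) : G i (enum_val j) by have := enum_valP j; rewrite inE.
have N_gt0 : 0 < #|N|.
  by have /existsP[j Gij] := valP u; apply/card_gt0P; exists j; rewrite inE.
have := domain_sum_tight1 dom N_gt0 (fun j => (aP _ (NP j)).1).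
have aval j : G i j -> a j i = 1 /\ a j j = 1.
  move=> Gij; have [tj] := aP _ Gij.
  have := tight1_le1 i tj; have := tight1_le1 j tj.
  by have := coversP _ _ (tight_covers tj) _ _ Gij; lia.
have sumi : (\sum_(j < #|N|) a (enum_val j))%MM i = #|N|.
  rewrite mnm_sumE (eq_bigr (fun=> 1)) ?sum1_card ?card_ord //.
  by move=> j _; have [] := aval _ (NP j).
move=> /tightP[_ /(_ i)]; rewrite sumi => /(_ N_gt0)[j Gij].
have jN : j \in N by rewrite inE.
rewrite mnm_sumE (bigD1 (enum_rank_in jN j)) //= enum_rankK_in //.
by rewrite (aval j Gij).2; lia.
Qed.

(** A basic 1-cover below the complement of a non-adjacent pair i', j' is positive at
both ends of the edge ij, since it vanishes at i' and j'. *)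
Lemma G01_WSC : no_isolated_vertex (G01 G) -> WSC G.
Proof.
move=> noiso; split=> // i ni.
have /existsP[[j nj]] := noiso (exist _ i ni).
rewrite /G01 /= /G01_adj /= => /andP[Gij /asboolP one]; exists j => // i' j' Gi Gj.
apply: contraT => nG.
(* The complement of {i', j'}. *)
pose a : 'X_{1..n} := [multinom ((u != i') && (u != j') : nat) | u < n].
have ca : covers 1 a.
  apply/coversP => u v Guv; rewrite !mnmE.
  apply: contraT; rewrite -leqNgt leqn0 addn_eq0 !eqb0 !negb_and !negbK.
  case/andP=> /orP[] /eqP eu /orP[] /eqP ev; move: Guv; rewrite eu ev ?adj_irr //.
    by rewrite (negbTE nG).
  by rewrite adj_sym (negbTE nG).
have [b /mnm_lepP ba tb] := covers_tight ca.
have cb := coversP _ _ (tight_covers tb).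
have bi : b i' = 0.
  by have := ba i'; rewrite mnmE eqxx; lia.
have bj : b j' = 0.
  by have := ba j'; rewrite mnmE eqxx andbF; lia.
have := one b ((basic_coverP b (isT : 0 < 1)).2 tb); have := cb _ _ Gi; have := cb _ _ Gj.
by lia.
Qed.

End Covers.

(** * Supports of products of polynomials *)

Local Open Scope ring_scope.

Section Supports.
Variables (R : idomainType) (n : nat).
Implicit Types (f g : {mpoly R[n]}) (a b m : 'X_{1..n}) (A B C : pred 'X_{1..n}).

Lemma all_msuppD A f g :
  all A (msupp f) -> all A (msupp g) -> all A (msupp (f + g)).
Proof.
move=> /allP Af /allP Ag; apply/allP => m /msuppD_le.
by rewrite mem_cat => /orP[/Af|/Ag].
Qed.

Lemma all_msupp_sum A (I : Type) (r : seq I) (P : pred I) (F : I -> {mpoly R[n]}) :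
  (forall i, P i -> all A (msupp (F i))) ->
  all A (msupp (\sum_(i <- r | P i) F i)).
Proof.
move=> AF; apply: (big_ind (fun f => all A (msupp f))) => //.
  by rewrite -mpolyC0 msupp0.
exact: all_msuppD.
Qed.

Lemma all_msuppM A B C f g :
  (forall a b, A a -> B b -> C (a + b)%MM) ->
  all A (msupp f) -> all B (msupp g) -> all C (msupp (f * g)).
Proof.
move=> ABC /allP Af /allP Bg; apply/allP => m /msuppM_le.
by move=> /allpairsP[[a b] /= [/Af Aa /Bg Bb ->]]; apply: ABC.
Qed.

Lemma has_largest (disp : Order.disp_t) (T : orderType disp) (A : pred T) (s : seq T) :
  has A s ->
  exists x, [/\ x \in s, A x & forall y, y \in s -> A y -> (y <= x)%O].
Proof.
elim: s => //= x s IHs; have [/IHs[z [zs Az zmax]] _|/hasPn nA] := boolP (has A s).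
  have [/andP[Ax zx]|nx] := boolP (A x && (z <= x)%O).
    exists x; rewrite inE eqxx; split=> // y; rewrite inE => /predU1P[->//|ys Ay].
    exact: Order.le_trans (zmax _ ys Ay) zx.
  exists z; rewrite inE zs orbT; split=> // y; rewrite inE => /predU1P[->|ys] Ay.
    by move: nx; rewrite Ay /= -Order.TotalTheory.ltNge => /Order.POrderTheory.ltW.
  exact: zmax.
rewrite orbF => Ax; exists x; rewrite inE eqxx; split=> // y.
by rewrite inE => /predU1P[->//|/nA/negP].
Qed.

(** Among the monomials of f in A and of g in B take the largest ones.  By the
hypothesis on C, only pairs in A and B can contribute to the coefficient of the
product of these two monomials, so that coefficient is a product of two nonzero
coefficients.  Used for orders of vanishing along (x_i, x_j) as well as for
tight monomials. *)
Lemma has_msuppM A B C f g :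
  {in msupp f & msupp g, forall a b, C (a + b)%MM = A a && B b} ->
  has A (msupp f) -> has B (msupp g) -> has C (msupp (f * g)).
Proof.
move=> ABC /has_largest[a [fa Aa amax]] /has_largest[b [gb Bb bmax]].
apply/hasP; exists (a + b)%MM; last by rewrite ABC ?Aa.
rewrite mcoeff_msupp mcoeffM.
have a_lt : (mdeg a < (mdeg (a + b)).+1)%N by rewrite mdegD ltnS leq_addr.
have b_lt : (mdeg b < (mdeg (a + b)).+1)%N by rewrite mdegD ltnS leq_addl.
rewrite (bigD1 (BMultinom a_lt, BMultinom b_lt)) //= big1 ?addr0.
  by rewrite mulf_neq0 // -mcoeff_msupp.
move=> [[a' a'_lt] [b' b'_lt]] /= /andP[/eqP e ne]; apply/eqP.
rewrite mulf_eq0 !mcoeff_eq0 -negb_and; apply: contra ne => /andP[fa' gb'].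
have /andP[Aa' Bb'] : A a' && B b' by rewrite -ABC // -e ABC ?Aa.
have aa' : a' = a.
  apply/eqP; have := amax _ fa' Aa'; rewrite Order.POrderTheory.le_eqVlt.
  case/orP=> // lt; have := ltmc_le_add lt (bmax _ gb' Bb').
  by rewrite -e Order.POrderTheory.ltxx.
have bb' : b' = b by move: e; rewrite aa' => /addmI.
by apply/eqP; congr (_, _); apply: val_inj.
Qed.

End Supports.

(** * Symbolic powers of the cover ideal *)

Section CoverIdeal.
Variables (K : fieldType) (n : nat) (G : sgraph 'I_n).
Implicit Types (f g : {mpoly K[n]}) (a b m : 'X_{1..n}).

Local Notation J := (cover_ideal K G).

(** For an edge ij these are the minimal primes of the cover ideal. *)
Definition edge_prime (i j : 'I_n) : {pred {mpoly K[n]}} :=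
  ideal_gen (fun g => g = 'X_i \/ g = 'X_j).

Lemma ideal_gen_mpoly (X : {mpoly K[n]} -> Prop) f :
  (forall a, a \in msupp f -> 'X_[a] \in ideal_gen X) -> f \in ideal_gen X.
Proof.
move=> fX; rewrite [f]mpolyE big_seq.
apply: (big_ind (fun g => g \in ideal_gen X)).
- exact: ideal_gen0.
- exact: ideal_genD.
by move=> a /fX aX; rewrite -mul_mpolyC; apply: ideal_genM.
Qed.

Lemma all_msuppX (A : pred 'X_{1..n}) a :
  all A (msupp ('X_[a] : {mpoly K[n]})) = A a.
Proof. by rewrite msuppX /= andbT. Qed.

Lemma all_msuppMr (A : pred 'X_{1..n}) f g :
  (forall a b, A b -> A (a + b)%MM) -> all A (msupp g) -> all A (msupp (f * g)).
Proof.
move=> up; apply: (@all_msuppM _ _ predT) => [a b _|]; first exact: up.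
exact: all_predT.
Qed.

Lemma edge_primeP i j f :
  reflect (all (fun a => 0 < a i + a j)%N (msupp f)) (f \in edge_prime i j).
Proof.
apply: (iffP idP) => [/asboolP[m [c [x [xX ->]]]]|/allP fij].
  apply: all_msupp_sum => u _; apply: all_msuppMr.
    by move=> a b; rewrite !mnmDE; lia.
  by case: (xX u) => ->; rewrite all_msuppX !mnm1E eqxx ?addn1.
apply: ideal_gen_mpoly => a /fij aij.
suff [l aP xl] : exists2 l, (U_(l) <= a)%MM & 'X_l \in edge_prime i j.
  by rewrite -(submK aP) mpolyXD; apply: ideal_genM.
case: (posnP (a i)) => ai.
  by exists j; [rewrite lep1mP; lia | apply: ideal_gen_base; right].
by exists i; [rewrite lep1mP; lia | apply: ideal_gen_base; left].
Qed.

Lemma cover_idealP f : reflect (all (covers G 1) (msupp f)) (f \in J).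
Proof.
apply: (iffP (asboolP _)) => [fJ|fJ i j Gij].
  apply/allP => a fa; apply/coversP => i j Gij.
  by have /edge_primeP/allP/(_ a fa) := fJ i j Gij.
apply/edge_primeP; apply: sub_all fJ => a /coversP; exact.
Qed.

(** A polynomial is outside the ideal when it has a monomial in neither variable,
and [has_msuppM] multiplies such monomials. *)
Lemma edge_prime_is_prime i j : prime_ideal (edge_prime i j).
Proof.
split; first split.
- exact: ideal_gen0.
- by apply/edge_primeP; rewrite msupp1 /= !mnm0E.
- by move=> a u v uI vI; apply: ideal_genD => //; apply: ideal_genM.
move=> f g /edge_primeP fg.
rewrite -[_ || _]negbK negb_or; apply/andP => -[/edge_primeP nf /edge_primeP ng].
move: fg nf ng; rewrite -[all _ (msupp (_ * _))]negbK -!has_predC => /negP fg.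
move=> /negP; rewrite -has_predC => nf /negP; rewrite -has_predC => ng; apply: fg.
by apply: has_msuppM nf ng => a b _ _ /=; rewrite !mnmDE; lia.
Qed.

Lemma prime_prod_notin (P : {pred {mpoly K[n]}}) (I : Type) (r : seq I)
    (Q : pred I) (F : I -> {mpoly K[n]}) :
  prime_ideal P -> (forall i, Q i -> F i \notin P) ->
  \prod_(i <- r | Q i) F i \notin P.
Proof.
move=> pP FP; apply: (big_ind (fun f => f \notin P)) => //; first exact: prime_ideal_notin1.
by move=> f g; apply: prime_ideal_notinM.
Qed.

(** Otherwise the vertices l with x_l outside P would form a vertex cover, and the
product of the corresponding variables would be in J but not in P. *)
Lemma prime_over_cover_ideal (P : {pred {mpoly K[n]}}) :
  prime_ideal P -> {subset J <= P} ->
  exists i j, [/\ G i j, 'X_i \in P & 'X_j \in P].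
Proof.
move=> pP JP; apply: contrapT => no.
have /negP := @prime_prod_notin P _ (index_enum 'I_n) (fun l => 'X_l \notin P)
  (fun l => 'X_l) pP (fun l => id).
apply; apply: JP; rewrite -(big_morph _ (@mpolyXD n K) (mpolyX0 n K)).
apply/cover_idealP.
rewrite all_msuppX; apply/coversP => i j Gij; rewrite !mnm_sumE.
have aE l : 'X_l \notin P -> (0 < \sum_(u | 'X_u \notin P) U_(u)%MM l)%N.
  by move=> lP; rewrite (bigD1 l) //= mnm1E eqxx.
have [iP|/aE] := boolP ('X_i \in P); last by move=> h; rewrite ltn_addr.
have [jP|/aE] := boolP ('X_j \in P); last by move=> h; rewrite ltn_addl.
by case: no; exists i, j.
Qed.

Lemma edge_prime_subset i j (P : {pred {mpoly K[n]}}) :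
  prime_ideal P -> 'X_i \in P -> 'X_j \in P -> {subset edge_prime i j <= P}.
Proof.
move=> [[P0 _ PM] _] iP jP f /asboolP[m [c [x [xX ->]]]].
apply: (big_ind (fun f => f \in P)) => //; first by move=> u v uP vP; rewrite -[u]mul1r PM.
by move=> u _; rewrite -[_ * _]addr0 PM //; case: (xX u) => ->.
Qed.

Lemma cover_ideal_sub_edge_prime i j : G i j -> {subset J <= edge_prime i j}.
Proof. by move=> Gij f /asboolP; apply. Qed.

(** A prime between J and (x_i, x_j) contains both variables of some edge, and the
only variables in (x_i, x_j) are x_i and x_j. *)
Lemma edge_prime_minimal i j : G i j -> minimal_prime J (edge_prime i j).
Proof.
move=> Gij; split; [exact: edge_prime_is_prime|exact: cover_ideal_sub_edge_prime|].
move=> Q pQ JQ Qij; have [u [v [Guv uQ vQ]]] := prime_over_cover_ideal pQ JQ.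
have mem w : 'X_w \in Q -> (w == i) || (w == j).
  move=> /Qij/edge_primeP; rewrite all_msuppX !mnm1E.
  by case: (w == i); case: (w == j).
have uv : u != v by apply: contraTneq Guv => ->; rewrite adj_irr.
have [iQ jQ] : 'X_i \in Q /\ 'X_j \in Q.
  case/orP: (mem u uQ) => /eqP eu; case/orP: (mem v vQ) => /eqP ev; subst=> //.
    by rewrite eqxx in uv.
  by rewrite eqxx in uv.
exact: edge_prime_subset.
Qed.

Lemma cover_ideal_pow k f : f \in ideal_pow J k -> all (covers G k) (msupp f).
Proof.
move=> /asboolP[m [c [x [xX ->]]]]; apply: all_msupp_sum => u _.
apply: all_msuppMr => [a b|]; first by move/(coversD (covers0 G a)).
have [y [yJ ->]] := xX u; elim: k y yJ {c x xX} => [|k IHk] y yJ.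
  by apply/allP => a _; apply: covers0.
rewrite big_ord_recl; apply: (@all_msuppM _ _ (covers G 1) (covers G k)).
- by move=> a b; apply: coversD.
- exact/cover_idealP.
- exact: IHk.
Qed.

Lemma ideal_powX k f : f \in J -> f ^+ k \in ideal_pow J k.
Proof.
move=> fJ; apply: ideal_gen_base; exists (fun=> f).
by split=> //; rewrite prodr_const card_ord.
Qed.

(** Localizing at P = (x_u, x_v) makes the other variables invertible.  With o the
product of these, x_u o and x_v o are in J, and o^k x^a is a multiple of a product
of k of them, since a u + a v >= k. *)
Lemma mon_sym_pow k a : covers G k a -> 'X_[a] \in sym_pow J k.
Proof.
move=> /coversP ca; apply/asboolP => P [pP JP minP].
have [u [v [Guv uP vP]]] := prime_over_cover_ideal pP JP.
have uv : u != v by apply: contraTneq Guv => ->; rewrite adj_irr.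
have Puv : {subset P <= edge_prime u v}.
  apply: minP; [exact: edge_prime_is_prime|exact: cover_ideal_sub_edge_prime|].
  exact: edge_prime_subset.
pose o : 'X_{1..n} := [multinom ((l != u) && (l != v) : nat) | l < n].
exists 'X_[o *+ k].
  apply/negP => /Puv/edge_primeP; rewrite all_msuppX !mulmnE !mnmE.
  by rewrite !eqxx andbF.
have oJ w : (w == u) || (w == v) -> 'X_[U_(w) + o] \in J.
  move=> uvw; apply/cover_idealP; rewrite all_msuppX; apply/coversP => i j Gij.
  rewrite !mnmDE !mnmE.
  have ij : i != j by apply: contraTneq Gij => ->; rewrite adj_irr.
  move: uvw ij => /orP[] /eqP ->.
    rewrite ![u == _]eq_sym; case: (i =P u) => //= _; case: (j =P u) => [|_] /=.
      by rewrite addnC.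
    by case: (i =P v) => //= ->; case: (j =P v) => // ->; rewrite eqxx.
  rewrite ![v == _]eq_sym; case: (i =P v) => //= _; case: (j =P v) => [|_] /=.
    by rewrite addnC.
  by rewrite !andbT; case: (i =P u) => //= ->; case: (j =P u) => // ->; rewrite eqxx.
(* The number of factors x_u o; the other k - p factors are x_v o. *)
pose p := minn (a u) k.
have ca' := ca u v Guv.
have le : ((U_(u) + o) *+ p + (U_(v) + o) *+ (k - p) <= o *+ k + a)%MM.
  apply/mnm_lepP => l; rewrite !(mnmDE, mulmnE, mnm1E, mnmE) ![_ == l]eq_sym.
  have [-> | lu] := eqVneq l u; first by rewrite (negbTE uv) /p; lia.
  by have [-> | lv] := eqVneq l v; rewrite /p /=; lia.
rewrite -mpolyXD -(submK le) mpolyXD; apply: ideal_genM.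
have pk : (p + (k - p))%N = k by rewrite subnKC // geq_minr.
rewrite mpolyXD -!mpolyXn -[X in _ \in ideal_pow _ X]pk.
by apply: ideal_powM; apply: ideal_powX; apply: oJ; rewrite eqxx ?orbT.
Qed.

(** Inclusion in the span of the monomials: the order of vanishing b_i + b_j along
(x_i, x_j) is additive on products, it is 0 for s outside this prime, and it is
at least k on J^k. *)
Lemma sym_powP k f : reflect (all (covers G k) (msupp f)) (f \in sym_pow J k).
Proof.
apply: (iffP idP) => [/asboolP fk|/allP fk].
  apply/allP => a fa; apply/coversP => i j Gij.
  have [s sP /cover_ideal_pow sf] := fk _ (edge_prime_minimal Gij).
  rewrite leqNgt; apply/negP => ak.
  (* The least order d of a monomial of f also occurs in s * f. *)
  pose w b := (b i + b j)%N.
  have [|d /hasP[b fb /eqP bd] dmin] := @ex_minnP (fun d => has (fun b => w b == d) (msupp f)).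
    by exists (w a); apply/hasP; exists a.
  have da : (d <= w a)%N by apply: dmin; apply/hasP; exists a.
  have : has (fun b => w b <= d)%N (msupp (s * f)).
    apply: (@has_msuppM _ _ (fun b => w b == 0)%N (fun b => w b <= d)%N).
    - move=> c e _ fe; have : (d <= w e)%N by apply: dmin; apply/hasP; exists e.
      by rewrite /w !mnmDE; lia.
    - move: sP => /edge_primeP/negP; rewrite -has_predC.
      by apply: sub_has => c /=; rewrite /w; lia.
    - by apply/hasP; exists b; rewrite ?bd.
  move=> /hasP[c sfc cd]; have := coversP _ _ _ (allP sf c sfc) _ _ Gij.
  by move: cd da ak; rewrite /w; lia.
rewrite [f]mpolyE big_seq; apply: (big_ind (fun g => g \in sym_pow J k)).
- exact: sym_pow_zero.
- exact: sym_powD.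
by move=> a /fk ca; rewrite -mul_mpolyC; apply/sym_powZ/mon_sym_pow.
Qed.

End CoverIdeal.

(** * The symbolic fiber cone *)

Section FiberCone.
Variables (K : fieldType) (n : nat) (G : sgraph 'I_n).
Implicit Types (f g : {mpoly K[n]}) (a b m : 'X_{1..n}).

Local Notation J := (cover_ideal K G).
Local Notation slack k := (fun a => ~~ tight G k a).

Lemma irrelevant_idealX i : 'X_i \in irrelevant_ideal K n.
Proof. by apply: ideal_gen_base; exists i. Qed.

Lemma rees_mon_subproof k a :
  covers G k a -> 'X_[a] *: 'X^k \in sym_rees_pred J.
Proof.
move=> ca; apply/asboolP => l; rewrite coefZ coefXn.
case: eqP => [->|_]; rewrite ?mulr1 ?mulr0 ?sym_pow_zero //.
exact: mon_sym_pow.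
Qed.

Definition rees_mon k a (ca : covers G k a) : sym_rees J :=
  SymRees (rees_mon_subproof ca).

Lemma rees_coef_covers (r : sym_rees J) k : all (covers G k) (msupp (val r)`_k).
Proof. by apply/sym_powP; have /asboolP := valP r. Qed.

(** Such a monomial is x_i times a monomial of the same degree in the Rees
algebra. *)
Lemma slack_mon_irrelevant k a (ca : covers G k a) :
  ~~ tight G k a -> rees_mon ca \in irrelevant_rees K G.
Proof.
move=> /(not_tightP ca)[i ia ci].
rewrite (_ : rees_mon ca = rees_mon ci * rees_const _ 'X_i).
  by apply: ideal_genM; apply: ideal_gen_base; exists 'X_i => //; apply: irrelevant_idealX.
apply: val_inj => /=.
rewrite -{1}(submK ia) mpolyXD.
by rewrite [RHS]mulrC mul_polyC scalerA mulrC.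
Qed.

(** Multiplying a monomial of the Rees algebra by a nontrivial monomial of degree 0
never gives a tight one, as a nonzero vector is not tight of degree 0. *)
Lemma irrelevant_reesP (r : sym_rees J) :
  reflect (forall k, all (slack k) (msupp (val r)`_k))
          (r \in irrelevant_rees K G).
Proof.
apply: (iffP idP) => [/asboolP[m [c [x [xX ->]]]] k|sl].
  rewrite raddf_sum coef_sum; apply: all_msupp_sum => u _ /=.
  have [f fm ->] := xX u; rewrite coefMC.
  apply: (@all_msuppM _ _ (covers G k) (fun b => b != 0%MM)).
  - move=> a b ca; apply: contraNN => tab; rewrite -(tight0 G).
    by apply: (tight_addr ca (covers0 G b)); rewrite addn0.
  - exact: rees_coef_covers.
  apply/allP => b; apply: contraTneq => ->.
  by rewrite mcoeff_msupp (irrelevant_ideal_mcoeff0 fm) eqxx.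
pose inI p := exists2 z : sym_rees J, z \in irrelevant_rees K G & val z = p.
have inI0 : inI 0 by exists 0; rewrite ?rpred0 ?rmorph0.
have inID p q : inI p -> inI q -> inI (p + q).
  move=> [y yI <-] [z zI <-]; exists (y + z); last by rewrite rmorphD.
  exact: ideal_genD.
suff [z zI /val_inj <-] : inI (val r) by [].
rewrite -[val r]coefK poly_def; apply: big_ind => // k _.
rewrite [(val r)`_k]mpolyE scaler_suml big_seq; apply: big_ind => // a ka.
have ca := allP (rees_coef_covers r k) a ka.
exists (rees_const _ ((val r)`_k@_a)%:MP * rees_mon ca).
  by apply: ideal_genM; apply: slack_mon_irrelevant; apply: (allP (sl k)).
by rewrite /= mul_polyC scalerA mul_mpolyC.
Qed.

Lemma rees_mon_irrelevant k a (ca : covers G k a) :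
  (rees_mon ca \in irrelevant_rees K G) = ~~ tight G k a.
Proof.
apply/idP/idP => [/irrelevant_reesP/(_ k)|]; last exact: slack_mon_irrelevant.
by rewrite /= coefZ coefXn eqxx mulr1 all_msuppX.
Qed.

Lemma pi_eq0 (r : sym_rees J) :
  (\pi_(basic_covers_algebra K G) r == 0)%qT = (r \in irrelevant_rees K G).
Proof. by rewrite -[r in RHS]subr0 Quotient.idealrBE rmorph0. Qed.

Lemma algebra_domain_tight_additive :
  GRing.integral_domain_axiom (basic_covers_algebra K G) -> tight_additive G.
Proof.
move=> dom k l a b ta tb; have ca := tight_covers ta; have cb := tight_covers tb.
apply: contraT; rewrite -(rees_mon_irrelevant (coversD ca cb)) => abI.
have e : rees_mon (coversD ca cb) = rees_mon ca * rees_mon cb.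
  by apply: val_inj; rewrite /= mpolyXD exprD -scalerAl -scalerAr scalerA.
move: abI; rewrite e -pi_eq0 rmorphM => /eqP/dom.
by rewrite !pi_eq0 !rees_mon_irrelevant ta tb.
Qed.

(** Choose k and l minimal such that f_k and g_l have a tight monomial.  In the
coefficient of degree k + l of f g, every product other than f_k g_l has a factor
of lower degree than k or l, hence no tight monomials, while f_k g_l has one by
[has_msuppM]. *)
Lemma tight_additive_algebra_domain :
  tight_additive G -> GRing.integral_domain_axiom (basic_covers_algebra K G).
Proof.
move=> tadd x y; rewrite -[x]reprK -[y]reprK -rmorphM => /eqP.
rewrite !pi_eq0; move: (repr x) (repr y) => f g /irrelevant_reesP fg.
have firstk (h : sym_rees J) : h \notin irrelevant_rees K G ->
  exists k, has (tight G k) (msupp (val h)`_k) /\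
            forall i, (i < k)%N -> all (slack i) (msupp (val h)`_i).
  move=> hI; have ex : exists k, has (tight G k) (msupp (val h)`_k).
    apply: contrapT => no; move: hI; apply/negP; rewrite negbK.
    apply/irrelevant_reesP => k; rewrite all_predC; apply/negP => tk.
    by apply: no; exists k.
  have [k tk kmin] := ex_minnP ex; exists k; split=> // i ik.
  by rewrite all_predC; apply/negP => /kmin; rewrite leqNgt ik.
apply: contraT; rewrite negb_or => /andP[/firstk[k [fk fmin]] /firstk[l [gl gmin]]].
have := fg (k + l)%N; rewrite all_predC => /negP[].
have tD i j a b : covers G i a -> covers G j b ->
    tight G (i + j) (a + b)%MM = tight G i a && tight G j b.
  move=> ca cb; apply/idP/andP => [tab|[ta tb]]; last exact: tadd.
  by split; [apply: tight_addl tab|apply: tight_addr tab].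
have fc i a : a \in msupp (val f)`_i -> covers G i a by apply/allP/rees_coef_covers.
have gc i a : a \in msupp (val g)`_i -> covers G i a by apply/allP/rees_coef_covers.
have tkl : has (tight G (k + l)) (msupp ((val f)`_k * (val g)`_l)).
  by apply: has_msuppM fk gl => a b /fc ca /gc cb; apply: tD.
apply: contraLR tkl; rewrite -!all_predC => kl.
have lt_k : (k < (k + l).+1)%N by rewrite ltnS leq_addr.
move: kl; rewrite rmorphM coefM (bigD1 (Ordinal lt_k)) //= addKn => kl.
rewrite -[_ * _](addrK (\sum_(i < (k + l).+1 | i != Ordinal lt_k)
  (val f)`_i * (val g)`_(k + l - i))).
apply: all_msuppD => //; rewrite (perm_all _ (msuppN _)).
apply: all_msupp_sum => i ne.
have i_le := leq_ord i.
have [ik|ki] := ltnP i k.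
  apply: (@all_msuppM _ _ (predI (covers G i) (slack i)) (covers G (k + l - i))).
  - move=> a b /= /andP[ca na] cb; rewrite -[in tight _ _](subnKC i_le).
    by rewrite tD // negb_and na.
  - by rewrite all_predI rees_coef_covers fmin.
  - exact: rees_coef_covers.
have il : (k + l - i < l)%N.
  have : (i : nat) <> k by move=> e; case/eqP: ne; apply: val_inj.
  by lia.
apply: (@all_msuppM _ _ (covers G i) (predI (covers G (k + l - i)) (slack (k + l - i)))).
- move=> a b ca /= /andP[cb nb]; rewrite -[in tight _ _](subnKC i_le).
  by rewrite tD // negb_and nb orbT.
- exact: rees_coef_covers.
- by rewrite all_predI rees_coef_covers gmin.
Qed.

End FiberCone.

Theorem theorem2p5 (K : fieldType) (n : nat) (hn : (0 < n)%N)
    (G : sgraph 'I_n) (hG : has_edge G) :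
  [<-> WSC G;
       graph_domain G;
       GRing.integral_domain_axiom (basic_covers_algebra K G);
       no_isolated_vertex (G01 G)].
Proof.
tfae.
- by move/WSC_tight_additive/(tight_additive_domain hG).
- move/(domain_G01 hG)/(G01_WSC hG)/WSC_tight_additive.
  exact: tight_additive_algebra_domain.
- move/algebra_domain_tight_additive/(tight_additive_domain hG).
  exact: domain_G01.
- exact: G01_WSC.
Qed.
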